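(* As formal power series in $q$, the generating functions for palindromic-gap partitions with odd and even numbers of parts are respectively $$\sum_{\lambda\in\mathcal{P}^{\mathrm{odd}}_{\mathrm{pal}}}q^{|\lambda|}=\sum_{m\ge 0}\frac{q^{2m+1}}{(1-q^{2m+1})^{m+1}}$$ and $$\sum_{\lambda\in\mathcal{P}^{\mathrm{even}}_{\mathrm{pal}}}q^{|\lambda|}=\sum_{m\ge 1}\frac{q^{2m}}{(1-q^{2m})^{m}(1-q^{m})}.$$ Consequently, $$\sum_{\lambda\in\mathcal{P}_{\mathrm{pal}}}q^{|\lambda|}=1+\sum_{m\ge 0}\frac{q^{2m+1}}{(1-q^{2m+1})^{m+1}}+\sum_{m\ge 1}\frac{q^{2m}}{(1-q^{2m})^{m}(1-q^{m})}.$$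
   Context: A partition is a finite sequence $\lambda=(\lambda_1,\dots,\lambda_\ell)$ of positive integers written in non-decreasing order $\lambda_1\le\cdots\le\lambda_\ell$ (the empty partition, $\ell=0$, is allowed). Its length (number of parts) is $\ell(\lambda)=\ell$ and its weight is $|\lambda|=\lambda_1+\cdots+\lambda_\ell$. A partition $\lambda$ is a palindromic-gap partition if its sequence of successive differences $(\lambda_2-\lambda_1,\dots,\lambda_\ell-\lambda_{\ell-1})$ is a palindrome, i.e. $\lambda_{i+1}-\lambda_i=\lambda_{\ell-i+1}-\lambda_{\ell-i}$ for all $1\le i\le \ell-1$; the empty partition and all one-part partitions satisfy this vacuously. $\mathcal{P}_{\mathrm{pal}}$ is the set of all palindromic-gap partitions (including the empty partition). $\mathcal{P}^{\mathrm{odd}}_{\mathrm{pal}}$ is the set of $\lambda\in\mathcal{P}_{\mathrm{pal}}$ with $\ell(\lambda)$ odd, and $\mathcal{P}^{\mathrm{even}}_{\mathrm{pal}}$ is the set of $\lambda\in\mathcal{P}_{\mathrm{pal}}$ with $\ell(\lambda)$ even and positive (so the empty partition is excluded). *)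

(* Defs.v *)
From HB Require Import structures.
From mathcomp Require Import all_boot all_order all_algebra.
From mathcomp Require Import boolp classical_sets functions cardinality fsbigop.

Set Implicit Arguments.
Unset Strict Implicit.
Unset Printing Implicit Defensive.

Import GRing.Theory.

Local Open Scope classical_set_scope.
Local Open Scope ring_scope.

Record fps (R : Type) := Fps { fcoef : nat -> R }.

Lemma fpsP (R : Type) (f g : fps R) : (forall n, fcoef f n = fcoef g n) -> f = g.
Proof. by case: f g => [f] [g] /= /funext ->. Qed.

HB.instance Definition _ (R : Type) := gen_eqMixin (fps R).
HB.instance Definition _ (R : Type) := gen_choiceMixin (fps R).

Section FpsRing.
Variable R : comNzRingType.
Implicit Types f g h : fps R.

Definition fps0 : fps R := Fps (fun=> 0).
Definition fps_opp f := Fps (fun n => - fcoef f n).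
Definition fps_add f g := Fps (fun n => fcoef f n + fcoef g n).
Definition fps1 : fps R := Fps (fun n => (n == 0%N)%:R).
Definition fps_mul f g :=
  Fps (fun n => \sum_(i < n.+1) fcoef f i * fcoef g (n - i)%N).

Fact fps_addA : associative fps_add.
Proof. by move=> f g h; apply: fpsP => n /=; rewrite addrA. Qed.
Fact fps_addC : commutative fps_add.
Proof. by move=> f g; apply: fpsP => n /=; rewrite addrC. Qed.
Fact fps_add0 : left_id fps0 fps_add.
Proof. by move=> f; apply: fpsP => n /=; rewrite add0r. Qed.
Fact fps_addN : left_inverse fps0 fps_opp fps_add.
Proof. by move=> f; apply: fpsP => n /=; rewrite addNr. Qed.

HB.instance Definition _ :=
  GRing.isZmodule.Build (fps R) fps_addA fps_addC fps_add0 fps_addN.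

Let trunc n f : {poly R} := \poly_(i < n.+1) fcoef f i.

Let coef_trunc n f i : (i <= n)%N -> (trunc n f)`_i = fcoef f i.
Proof. by move=> le_in; rewrite coef_poly ltnS le_in. Qed.

Let coef_truncM n f g i :
  (i <= n)%N -> (trunc n f * trunc n g)`_i = fcoef (fps_mul f g) i.
Proof.
move=> le_in; rewrite coefM; apply: eq_bigr => j _.
rewrite !coef_trunc ?(leq_trans (leq_subr _ _) le_in) //.
by rewrite (leq_trans _ le_in) // -ltnS.
Qed.

Fact fps_mulC : commutative fps_mul.
Proof.
by move=> f g; apply: fpsP => n; rewrite -!(coef_truncM (n := n)) // mulrC.
Qed.

Fact fps_mulA : associative fps_mul.
Proof.
move=> f g h; apply: fpsP => n.
transitivity (trunc n f * (trunc n g * trunc n h))`_n.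
  rewrite coefM; apply: eq_bigr => i _.
  by rewrite coef_truncM ?leq_subr // coef_trunc // -ltnS.
rewrite mulrA coefM; apply: eq_bigr => i _.
by rewrite coef_truncM -1?ltnS // coef_trunc ?leq_subr.
Qed.

Fact fps_mul1 : left_id fps1 fps_mul.
Proof.
move=> f; apply: fpsP => n /=; rewrite big_ord_recl big1 ?addr0 ?subn0 ?mul1r //.
by move=> i _; rewrite mul0r.
Qed.

Fact fps_mulDl : left_distributive fps_mul fps_add.
Proof.
move=> f g h; apply: fpsP => n /=; rewrite -big_split.
by apply: eq_bigr => i _; rewrite mulrDl.
Qed.

Fact fps1_neq0 : fps1 != fps0.
Proof. by apply/eqP => /(congr1 (fun f => fcoef f 0)) /eqP; rewrite oner_eq0. Qed.

HB.instance Definition _ := GRing.Zmodule_isComNzRing.Build (fps R)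
  fps_mulA fps_mulC fps_mul1 fps_mulDl fps1_neq0.

Definition fps_unit : pred (fps R) := fun f => `[< exists g, g * f = 1 >].

(* As for every unitRingType, a series without inverse is its own junk inverse;
   fps_unit_sub1X shows that 1 - q^k is a genuine unit for k > 0. *)
Definition fps_inv f : fps R :=
  if pselect (exists g, g * f = 1) is left ex_g then projT1 (cid ex_g) else f.

Fact fps_mulV : {in fps_unit, left_inverse 1 fps_inv *%R}.
Proof.
move=> f /asboolP ex_g; rewrite /fps_inv; case: pselect => // ex_g'.
by case: cid.
Qed.
Fact fps_unitPl f g : g * f = 1 -> fps_unit f.
Proof. by move=> gf1; apply/asboolP; exists g. Qed.
Fact fps_inv_out : {in [predC fps_unit], fps_inv =1 id}.
Proof.
move=> f /negP nUf; rewrite /fps_inv; case: pselect => // ex_g.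
by case: nUf; apply/asboolP.
Qed.

HB.instance Definition _ := GRing.ComNzRing_hasMulInverse.Build (fps R)
  fps_mulV fps_unitPl fps_inv_out.

Definition fpsX : fps R := Fps (fun n => (n == 1%N)%:R).

(* A family (F i)_(i in A) is summable when each power of q occurs in only
   finitely many F i; the sum is then computed coefficientwise.  The finitely
   supported sum below is 0 by convention on infinite supports, so fps_sum is
   meaningful only for summable families. *)
Definition fps_summable (I : choiceType) (A : set I) (F : I -> fps R) :=
  forall n, finite_set (A `&` [set i | fcoef (F i) n != 0]).

Definition fps_sum (I : choiceType) (A : set I) (F : I -> fps R) : fps R :=
  Fps (fun n => \sum_(i \in A) fcoef (F i) n).

Lemma fcoefB f g n : fcoef (f - g) n = fcoef f n - fcoef g n.
Proof. by []. Qed.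

Lemma fcoefM f g n :
  fcoef (f * g) n = \sum_(i < n.+1) fcoef f i * fcoef g (n - i)%N.
Proof. by []. Qed.

Lemma fcoefXn k n : fcoef (fpsX ^+ k) n = (n == k)%:R.
Proof.
elim: k n => [|k IHk] [|n] //; rewrite exprS fcoefM.
  by rewrite big_ord_recl big_ord0 /= mul0r addr0.
rewrite big_ord_recl /= mul0r add0r big_ord_recl /= mul1r IHk subSS subn0 eqSS.
by rewrite big1 ?addr0 // => i _; rewrite mul0r.
Qed.

Lemma fps_unit_sub1X k : (0 < k)%N -> 1 - fpsX ^+ k \is a GRing.unit.
Proof.
move=> k_gt0; apply/asboolP; exists (Fps (fun n => (k %| n)%:R)).
apply: fpsP => n; rewrite mulrBr mulr1 fcoefB fcoefM /=.
case: (leqP k n) => [le_kn|lt_nk].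
  have lt_nkn : (n - k < n.+1)%N by rewrite ltnS leq_subr.
  rewrite (bigD1 (Ordinal lt_nkn)) //= big1 => [|i ne_i].
    rewrite fcoefXn subKn // eqxx mulr1 addr0 dvdn_subl // subrr.
    by rewrite -[n == 0%N]negbK -lt0n (leq_trans k_gt0 le_kn).
  rewrite fcoefXn [_ == k]negbTE ?mulr0 //; apply: contraNneq ne_i => def_k.
  by rewrite -val_eqE /= -def_k subKn // -ltnS.
rewrite big1 ?subr0 => [|i _].
  case: n lt_nk => [|n] lt_nk; first by rewrite dvdn0.
  by rewrite gtnNdvd.
rewrite fcoefXn [_ == k]negbTE ?mulr0 // neq_ltn.
by rewrite (leq_ltn_trans (leq_subr _ _) lt_nk).
Qed.

End FpsRing.

Notation "'q" := (fpsX int) (at level 0) : ring_scope.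
Notation "\fps_sum_ ( i '\in' A ) F" := (fps_sum A (fun i => F))
  (at level 36, F at level 36, i at level 50,
   format "'[' \fps_sum_ ( i  '\in'  A ) '/  '  F ']'") : ring_scope.

Definition is_partition (l : seq nat) : bool :=
  sorted leq l && all (fun p => (0 < p)%N) l.

Definition weight (l : seq nat) : nat := sumn l.

(* Truncated subtraction is harmless here: partitions are non-decreasing. *)
Definition gaps (l : seq nat) : seq nat :=
  mkseq (fun i => (nth 0 l i.+1 - nth 0 l i)%N) (size l).-1.

Definition palindrome (s : seq nat) : bool := rev s == s.

Definition Ppal : set (seq nat) :=
  [set l | is_partition l && palindrome (gaps l)].

Definition Ppal_odd : set (seq nat) := Ppal `&` [set l | odd (size l)].

Definition Ppal_even : set (seq nat) :=
  Ppal `&` [set l | ~~ odd (size l) && (0 < size l)%N].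

(* Main.v *)
Require Import Defs.
From HB Require Import structures.
From mathcomp Require Import all_boot all_order all_algebra.
From mathcomp Require Import boolp classical_sets functions cardinality fsbigop.
From mathcomp Require Import zify.

Set Implicit Arguments.
Unset Strict Implicit.
Unset Printing Implicit Defensive.

Import GRing.Theory.

Local Open Scope classical_set_scope.
Local Open Scope ring_scope.

(** A nonempty partition is its smallest part a together with its sequence of
    gaps g, and the palindrome condition says that g is determined by its first
    half d and, if the number of gaps is odd, by the middle gap x.  Adding the
    partition with gaps g, entry by entry, to the one with the reversed gaps
    read backwards gives a constant sequence ([sumn_steps_rev]), so that for a
    palindrome twice the weight is the number of parts times the sum of the
    extreme parts ([weight_pal_steps]).  Hence

    - with n = 2m+1 parts, the parameters are a >= 1 and m gaps d_i >= 0, and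
      the weight is n (a + d_1 + ... + d_m);
    - with n = 2m parts, the parameters are a >= 1, m-1 gaps d_i >= 0 and the
      middle gap x >= 0, and the weight is n (a + d_1 + ... + d_(m-1)) + m x.

    Writing a = a' + 1, the weight is n plus a linear form with positive
    coefficients in free natural number parameters.  Summing q to the power of
    such a form gives the product of the geometric series 1/(1 - q^e), one for
    each coefficient e ([fps_sum_dotn]); multiplied by q^n, this is the m-th
    term of the announced series.  It remains to group the partitions by number of parts; this is a
    Fubini argument for summable families ([fps_sum_fiber]), which also shows
    that the series of closed forms is summable. *)

(** * Sums of summable families of power series *)

Section FpsSum.
Variable R : comNzRingType.
Implicit Types f g : fps R.
Local Notation X := (fpsX R).

Lemma fcoef_mulXn k f n :
  fcoef (X ^+ k * f) n = if (k <= n)%N then fcoef f (n - k) else 0.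
Proof.
rewrite fcoefM; case: leqP => [le_kn|lt_nk].
  have lt_k : (k < n.+1)%N by [].
  rewrite (bigD1 (Ordinal lt_k)) //= fcoefXn eqxx mul1r big1 ?addr0 // => i.
  by rewrite -val_eqE fcoefXn /= => /negbTE ->; rewrite mul0r.
rewrite big1 // => i _; rewrite fcoefXn.
by rewrite [_ == k]negbTE ?mul0r // neq_ltn (leq_trans (ltn_ord i)).
Qed.

Lemma eq_fps_sum (I : choiceType) (A : set I) (F G : I -> fps R) :
  (forall i, A i -> F i = G i) -> fps_sum A F = fps_sum A G.
Proof.
move=> eqFG; apply: fpsP => n /=.
by apply: eq_fsbigr => i /set_mem Ai; rewrite eqFG.
Qed.

Lemma fps_sum_image (I J : choiceType) (A : set I) (h : I -> J)
    (F : J -> fps R) :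
  {in A &, injective h} -> fps_sum (h @` A) F = fps_sum A (F \o h).
Proof. by move=> h_inj; apply: fpsP => n /=; rewrite fsbig_image. Qed.

Lemma fps_sum_set1 (I : choiceType) (i : I) (F : I -> fps R) :
  fps_sum [set i] F = F i.
Proof. by apply: fpsP => n /=; rewrite fsbig_set1. Qed.

Lemma fps_sum_mulXn (I : choiceType) (A : set I) (F : I -> fps R) k :
  fps_sum A (fun i => X ^+ k * F i) = X ^+ k * fps_sum A F.
Proof.
apply: fpsP => n; rewrite fcoef_mulXn; case: ifP => le_kn.
  by apply: eq_fsbigr => i _; rewrite fcoef_mulXn le_kn.
by apply: fsbig1 => i _; rewrite fcoef_mulXn le_kn.
Qed.

Lemma fps_summable_set1 (I : choiceType) (i : I) (F : I -> fps R) :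
  fps_summable [set i] F.
Proof. by move=> n; apply: sub_finite_set (finite_set1 i) => j []. Qed.

Lemma sub_fps_summable (I : choiceType) (A B : set I) (F : I -> fps R) :
  A `<=` B -> fps_summable B F -> fps_summable A F.
Proof.
by move=> sAB sumB n; apply: sub_finite_set (sumB n) => i [/sAB Bi ?]; split.
Qed.

Lemma fps_sumE (I : choiceType) (A : set I) (F : I -> fps R) n :
  fcoef (fps_sum A F) n =
  \sum_(i \in A `&` [set i | fcoef (F i) n != 0]) fcoef (F i) n.
Proof.
apply/esym/fsbig_widen; first by move=> i [].
by move=> i [Ai /not_andP[//|/negP/negPn/eqP]].
Qed.

Lemma fps_sumU (I : choiceType) (A B : set I) (F : I -> fps R) :
  fps_summable A F -> fps_summable B F -> A `&` B `<=` set0 ->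
  fps_sum (A `|` B) F = fps_sum A F + fps_sum B F.
Proof.
move=> sumA sumB AB0; apply: fpsP => n.
rewrite [RHS]/(fcoef (fps_sum A F) n + fcoef (fps_sum B F) n).
rewrite !fps_sumE setIUl fsbigU0 // => i [[Ai _] [Bi _]].
by apply: (AB0 i); split.
Qed.

(** Summation by fibers of k.  At a given coefficient only a finite set S of
    indices contributes, so only the finite image of S matters among the
    fibers: this gives the summability of the fiber sums and reduces the
    equality to the exchange of two finite sums. *)
Lemma fps_sum_fiber (I J : choiceType) (A : set I) (B : set J) (k : I -> J)
    (F : I -> fps R) (G : J -> fps R) :
    fps_summable A F -> (forall i, A i -> B (k i)) ->
    (forall j, B j -> G j = fps_sum (A `&` [set i | k i = j]) F) ->
  fps_summable B G /\ fps_sum A F = fps_sum B G.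
Proof.
move=> sumA ABk defG.
have out n j : B j -> ~ (k @` (A `&` [set i | fcoef (F i) n != 0])) j ->
    fcoef (G j) n = 0.
  move=> Bj notTj; rewrite defG //= fsbig1 // => i [Ai kij].
  by have [//|Fi_neq0] := eqVneq (fcoef (F i) n) 0; case: notTj; exists i.
split=> [n|].
  apply: sub_finite_set (finite_image k (sumA n)) => j [Bj Gj_neq0].
  by apply: contrapT => /(out n j Bj) Gj0; rewrite /= Gj0 eqxx in Gj_neq0.
apply: fpsP => n; set S := A `&` [set i | fcoef (F i) n != 0].
have finS : finite_set S by apply: sumA.
transitivity (\sum_(j \in k @` S) fcoef (G j) n); last first.
  apply: fsbig_widen => [j [i [Ai _] <-]|j [Bj notTj]]; first exact: ABk.
  exact: out.
transitivity (\sum_(j \in k @` S) \sum_(i \in S)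
    (if i \in [set i | k i = j] then fcoef (F i) n else 0)); last first.
  apply: eq_fsbigr => j /set_mem [i0 [Ai0 _] ki0j].
  rewrite -fsbig_mkcondr defG -?ki0j; last exact: ABk.
  by rewrite fps_sumE; apply: eq_fsbigl; rewrite /S setIAC.
rewrite exchange_fsbig //; last exact: finite_image.
rewrite fps_sumE; apply: eq_fsbigr => i /set_mem Si.
(* the index i lies in exactly one fiber *)
rewrite -(@fsbig_widen _ _ _ _ [set k i]) ?fsbig_set1 ?ifT ?inE //.
  by move=> j ->; exists i.
move=> j [_ /= kij]; rewrite ifF //; apply/negbTE.
by rewrite notin_setE /= => /esym.
Qed.

End FpsSum.

(** * Products of geometric series *)

Lemma finite_bounded_seqs N M :
  finite_set [set s : seq nat | (size s <= N)%N && all (fun x => x <= M)%N s].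
Proof.
elim: N => [|N IHN].
  by apply: sub_finite_set (finite_set1 [::]) => -[|x s].
apply: (@sub_finite_set _ _ ([set [::]] `|`
  [set x :: s | x in `I_M.+1 & s in
     [set s : seq nat | (size s <= N)%N && all (fun x => x <= M)%N s]])).
  move=> [|x s] /=; first by left.
  move=> /and3P[size_s le_xM all_s]; right; exists x => //.
  by exists s => //; apply/andP.
by rewrite finite_setU; split => //; apply: finite_image2.
Qed.

Section GeometricProducts.
Variable R : comNzRingType.
Local Notation X := (fpsX R).

Definition dotn (c es : seq nat) : nat :=
  sumn [seq p.1 * p.2 | p <- zip c es]%N.

Lemma dotn_nseq c e : dotn c (nseq (size c) e) = (e * sumn c)%N.
Proof.
rewrite /dotn; elim: c => [|x c IHc] /=; first by rewrite muln0.
by rewrite IHc mulnDr mulnC.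
Qed.

Lemma leq_dotn c es : size c = size es -> all (leq 1) es ->
  all (fun x => x <= dotn c es)%N c.
Proof.
elim: c es => [|x c IHc] [|e es] //= [eq_size] /andP[e_gt0 es_gt0].
rewrite /dotn /= -/(dotn c es) (leq_trans (leq_pmulr x e_gt0)) ?leq_addr //=.
apply: sub_all (IHc es eq_size es_gt0) => y le_y.
by rewrite (leq_trans le_y) ?leq_addl.
Qed.

Lemma summable_dotn es : all (leq 1) es ->
  fps_summable [set c : seq nat | size c = size es] (fun c => X ^+ dotn c es).
Proof.
move=> es_gt0 n; apply: sub_finite_set (finite_bounded_seqs (size es) n).
move=> c [/= eq_size]; rewrite fcoefXn.
have [-> _|] := eqVneq n; last by rewrite eqxx.
by rewrite eq_size leqnn leq_dotn.
Qed.

(** Let G and H be the sums for e :: es and for es.  The vectors with a zero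
    first entry contribute H to G, and those with a positive first entry
    contribute X^e G, by lowering that entry by one.  So (1 - X^e) G = H. *)
Lemma fps_sum_dotn es : all (leq 1) es ->
  fps_sum [set c : seq nat | size c = size es] (fun c => X ^+ dotn c es)
  = (\prod_(e <- es) (1 - X ^+ e))^-1.
Proof.
elim: es => [_|e es IHes].
  rewrite big_nil invr1 (_ : [set c | _] = [set [::]]) ?fps_sum_set1 //.
  by apply/seteqP; split=> [[]|_ ->].
move=> /[dup] es_gt0 /andP[e_gt0 {}/IHes]; move: es_gt0.
set V := [set c | size c = size es].
set V' := [set c | size c = size (e :: es)].
set H := fps_sum V _ => es_gt0 defH; set G := fps_sum V' _.
pose incr c := (head 0 c).+1 :: behead c.
have incr_inj : {in V' &, injective incr}.
  by move=> [|x c] [|y d] // /set_mem + /set_mem + [] => // _ _ -> ->.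
have defV' : V' = (cons 0 @` V) `|` (incr @` V').
  apply/seteqP; split=> [[|[|x] c] //= [eq_size]|c].
  - by left; exists c.
  - by right; exists (x :: c) => //=; rewrite /V' /= eq_size.
  by case=> [[d + <-]|[[|x d] // + <-]]; rewrite /V /V' /= => ->.
have defG : G = H + X ^+ e * G.
  have sumG := @summable_dotn _ es_gt0.
  rewrite {1}/G {1}defV' fps_sumU; first last.
  - by move=> c [[d _ <-] [d' _ []]].
  - by apply: sub_fps_summable sumG; rewrite -/V' [W in _ `<=` W]defV'; right.
  - by apply: sub_fps_summable sumG; rewrite -/V' [W in _ `<=` W]defV'; left.
  rewrite !fps_sum_image //; last by move=> c d _ _ [].
  congr (_ + _).
  rewrite /G -fps_sum_mulXn; apply: eq_fps_sum => -[|x c] //= _.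
  by rewrite /dotn /= -exprD addnA mulSn.
have Ue := @fps_unit_sub1X R e e_gt0.
rewrite big_cons invrM //; last first.
  apply: unitr_prod_in => i i_es _; apply: fps_unit_sub1X.
  by apply: (allP es_gt0); rewrite inE i_es orbT.
rewrite -defH; apply: canRL (mulrK Ue) _.
by rewrite mulrC mulrBl mul1r {1}defG addrK.
Qed.

End GeometricProducts.

(** * Partitions and their gaps *)

(** The inverse of [gaps], once the first entry a is known. *)
Definition steps (a : nat) (g : seq nat) : seq nat := a :: scanl addn a g.

Lemma gaps_cons a s : gaps (a :: s) = pairmap (fun x y => (y - x)%N) a s.
Proof.
apply: (@eq_from_nth _ 0%N); first by rewrite size_mkseq size_pairmap.
move=> i; rewrite size_mkseq => lt_i.
by rewrite nth_mkseq // (nth_pairmap 0%N).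
Qed.

Lemma gaps_steps a g : gaps (steps a g) = g.
Proof. by rewrite gaps_cons scanlK // => x d; rewrite addKn. Qed.

Lemma steps_gaps a s : sorted leq (a :: s) -> steps a (gaps (a :: s)) = a :: s.
Proof.
rewrite gaps_cons /steps => path_s; congr (_ :: _).
by elim: s a path_s => //= x s IHs a /andP[le_ax /IHs]; rewrite subnKC // => ->.
Qed.

Lemma is_partition_steps a g : is_partition (steps a.+1 g).
Proof.
rewrite /is_partition /=; elim: g a => //= d g IHg a.
by rewrite addSn leq_addr /= IHg.
Qed.

(** The i-th entry of the first sequence and the i-th entry from the end of the
    second one add up to 2a + sumn g, because the gaps passed on one side are
    those that remain on the other. *)
Lemma sumn_steps_rev a g :
  (sumn (steps a g) + sumn (steps a (rev g)) =
   (size g).+1 * (2 * a + sumn g))%N.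
Proof.
have shift b x s : (sumn (scanl addn (b + x) s) =
    sumn (scanl addn b s) + x * size s)%N.
  elim: s b => [|y s IHs] b /=; first by rewrite muln0.
  by rewrite (addnAC b x) IHs; lia.
have foldl_sum b s : foldl addn b s = (b + sumn s)%N.
  by elim: s b => [|y s IHs] b /=; rewrite ?addn0 ?IHs ?addnA.
elim: g => [|x g IHg] /=; first by lia.
move: IHg; rewrite /steps /= rev_cons scanl_rcons shift sumn_rcons -cats1.
rewrite foldl_cat /= foldl_sum sumn_rev; nia.
Qed.

(** The partition with smallest part a + 1 whose gaps are d, then mid, then d
    mirrored.  The middle block is empty for an odd number of parts and a single
    gap for an even one; the shift makes a free in nat. *)
Definition pal_steps (mid : seq nat) a d := steps a.+1 (d ++ mid ++ rev d).
Arguments pal_steps : simpl never.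

Lemma size_pal_steps mid a d :
  size (pal_steps mid a d) = (size d + size mid + size d).+1.
Proof. by rewrite /pal_steps /= size_scanl !size_cat size_rev addnA. Qed.

Lemma weight_pal_steps mid a d : rev mid = mid ->
  (2 * weight (pal_steps mid a d) =
   size (pal_steps mid a d) * (2 * (a.+1 + sumn d) + sumn mid))%N.
Proof.
move=> rev_mid; have := sumn_steps_rev a.+1 (d ++ mid ++ rev d).
rewrite !rev_cat revK rev_mid -catA addnn -mul2n -/(pal_steps mid a d) /weight.
by move=> ->; rewrite !sumn_cat sumn_rev size_pal_steps !size_cat size_rev; lia.
Qed.

Lemma Ppal_steps mid a d : rev mid = mid -> Ppal (pal_steps mid a d).
Proof.
move=> rev_mid; rewrite /Ppal /= is_partition_steps gaps_steps /palindrome.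
by rewrite !rev_cat revK rev_mid -catA eqxx.
Qed.

(** In a palindrome the last k gaps mirror the first k, which leaves a block of
    j gaps between them. *)
Lemma Ppal_stepsP k j l : Ppal l -> size l = (k + j + k).+1 ->
  exists mid a d, [/\ size mid = j, size d = k & l = pal_steps mid a d].
Proof.
case: l => // -[|a] s; rewrite /Ppal /is_partition /=; first by rewrite andbF.
move=> /andP[/andP[path_s _] pal_g] [size_s].
set g := gaps (a.+1 :: s) in pal_g.
have size_g : size g = (k + j + k)%N by rewrite /g gaps_cons size_pairmap.
exists (take j (drop k g)), a, (take k g).
rewrite !size_takel ?size_drop ?size_g; try by lia.
split=> //; rewrite -(steps_gaps path_s) -/g /pal_steps; congr steps.
rewrite rev_take (eqP pal_g) -{1}[g](cat_take_drop k); congr (_ ++ _).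
rewrite -{1}[drop k g](cat_take_drop j) drop_drop; congr (_ ++ drop _ _); lia.
Qed.

Lemma pal_steps_inj mid mid' a a' d d' :
    size mid = size mid' -> size d = size d' ->
  pal_steps mid a d = pal_steps mid' a' d' -> [/\ mid = mid', a = a' & d = d'].
Proof.
move=> eq_mid eq_d eq_l; have [eq_a _] := eq_l.
have := congr1 gaps eq_l; rewrite !gaps_steps => /eqP.
by rewrite !eqseq_cat // => /and3P[/eqP -> /eqP -> _].
Qed.

(** Positive parts bound both the length and the entries by the weight. *)
Lemma summable_Ppal : fps_summable Ppal (fun l => 'q ^+ weight l).
Proof.
move=> n; apply: sub_finite_set (finite_bounded_seqs n n) => l.
case=> /andP[/andP[_ pos_l] _].
rewrite /= fcoefXn; have [-> _|] := eqVneq n; last by rewrite eqxx.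
rewrite /weight; elim: l pos_l => //= x l IHl.
move=> /andP[x_gt0 /IHl/andP[size_l all_l]].
rewrite leq_addr /=; apply/andP; split; first by lia.
by apply: sub_all all_l => y; lia.
Qed.

(** * Generating functions for a fixed number of parts *)

(** The parameter vectors are packed as sequences so that the weight becomes a
    [dotn]; sequences too short to hold the parameters go to the empty one. *)
Definition odd_pal (c : seq nat) : seq nat :=
  if c is a :: d then pal_steps [::] a d else [::].
Definition even_pal (c : seq nat) : seq nat :=
  if c is x :: a :: d then pal_steps [:: x] a d else [::].

Lemma fps_sum_odd_length m :
  \fps_sum_(l \in Ppal_odd `&` [set l | (size l)./2 = m]) 'q ^+ weight l =
  'q ^+ (2 * m + 1) / (1 - 'q ^+ (2 * m + 1)) ^+ (m + 1).
Proof.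
set n := (2 * m + 1)%N; pose es := nseq (m + 1) n.
have -> : Ppal_odd `&` [set l | (size l)./2 = m] =
    Ppal `&` [set l | size l = n].
  apply/seteqP; split=> l /=; [case=> -[pal_l] /= | case=> pal_l] => *.
    by split=> //; lia.
  by split; [split=> //= | ]; lia.
have -> : Ppal `&` [set l | size l = n] = odd_pal @` [set c | size c = size es].
  rewrite /es size_nseq; apply/seteqP.
  split=> [l [pal_l /= size_l]|_ [c size_c <-]].
    have /(Ppal_stepsP pal_l) : size l = (m + 0 + m).+1 by lia.
    case=> [[|x mid] [a [d [// _ size_d ->]]]].
    by exists (a :: d) => //=; rewrite size_d addn1.
  case: c size_c => [|a d] /= size_c; first by lia.
  split; first exact: Ppal_steps.
  change (size (pal_steps [::] a d) = n).
  by rewrite size_pal_steps /=; lia.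
rewrite fps_sum_image; last first.
  move=> c c' /set_mem + /set_mem; rewrite /es /= size_nseq addn1.
  case: c c' => [|a d] [|b e] //= [size_d] [size_e].
  by case/pal_steps_inj => [||_ -> ->] //; rewrite size_d size_e.
rewrite (eq_fps_sum (G := fun c => 'q ^+ n * 'q ^+ dotn c es)) => [|c].
  rewrite fps_sum_mulXn fps_sum_dotn; last by rewrite all_nseq; lia.
  by rewrite /es big_nseq iter_mulr_1.
rewrite /= /es size_nseq => size_c.
rewrite -exprD -size_c dotn_nseq; congr (_ ^+ _).
case: c size_c => [|a d] /= size_c; first by lia.
have := @weight_pal_steps [::] a d erefl; rewrite size_pal_steps /= /n; nia.
Qed.

Lemma fps_sum_even_length m : (0 < m)%N ->
  \fps_sum_(l \in Ppal_even `&` [set l | (size l)./2 = m]) 'q ^+ weight l =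
  'q ^+ (2 * m) / ((1 - 'q ^+ (2 * m)) ^+ m * (1 - 'q ^+ m)).
Proof.
move=> m_gt0; set n := (2 * m)%N; pose es := m :: nseq m n.
have -> : Ppal_even `&` [set l | (size l)./2 = m] =
    Ppal `&` [set l | size l = n].
  apply/seteqP; split=> l /=; [case=> -[pal_l] /= | case=> pal_l] => *.
    by split=> //; lia.
  by split; [split=> //= | ]; lia.
have -> : Ppal `&` [set l | size l = n] =
    even_pal @` [set c | size c = size es].
  rewrite /es /= size_nseq; apply/seteqP.
  split=> [l [pal_l /= size_l]|_ [c size_c <-]].
    have /(Ppal_stepsP pal_l) : size l = (m.-1 + 1 + m.-1).+1 by lia.
    case=> [[|x [|y mid]] [a [d [// _ size_d ->]]]].
    by exists (x :: a :: d) => //=; rewrite size_d prednK.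
  case: c size_c => [|x [|a d]] /= size_c; try by lia.
  split; first exact: Ppal_steps.
  change (size (pal_steps [:: x] a d) = n).
  by rewrite size_pal_steps /=; lia.
rewrite fps_sum_image; last first.
  move=> c c' /set_mem + /set_mem.
  rewrite /es /= size_nseq => -[size_c] [size_c'].
  case: c c' size_c size_c' => [|x [|a d]] [|y [|b e]] /=; try lia.
  move=> size_d size_e; case/pal_steps_inj => [||[->] -> ->] //; lia.
rewrite (eq_fps_sum (G := fun c => 'q ^+ n * 'q ^+ dotn c es)) => [|c].
  rewrite fps_sum_mulXn fps_sum_dotn; last by rewrite /= all_nseq m_gt0 /n; lia.
  by rewrite /es big_cons big_nseq iter_mulr_1 [X in _ / X]mulrC.
rewrite /= /es /= size_nseq => size_c; rewrite -exprD; congr (_ ^+ _).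
case: c size_c => [|x [|a d]] /= [size_c]; try by lia.
rewrite /dotn /= -/(dotn (a :: d) (nseq m n)) -size_c dotn_nseq /=.
have := @weight_pal_steps [:: x] a d erefl; rewrite size_pal_steps /= /n; nia.
Qed.

(** * The generating functions *)

Theorem theorem1 :
  let oddF (m : nat) : fps int :=
    'q ^+ (2 * m + 1) / (1 - 'q ^+ (2 * m + 1)) ^+ (m + 1) in
  let evenF (m : nat) : fps int :=
    'q ^+ (2 * m) / ((1 - 'q ^+ (2 * m)) ^+ m * (1 - 'q ^+ m)) in
  let Fodd : fps int := \fps_sum_(m \in [set m : nat | (0 <= m)%N]) oddF m in
  let Feven : fps int := \fps_sum_(m \in [set m : nat | (1 <= m)%N]) evenF m in
  [/\ [/\ fps_summable Ppal (fun l => 'q ^+ weight l),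
          fps_summable Ppal_odd (fun l => 'q ^+ weight l) &
          fps_summable Ppal_even (fun l => 'q ^+ weight l)],
      fps_summable [set m : nat | (0 <= m)%N] oddF
        /\ fps_summable [set m : nat | (1 <= m)%N] evenF,
      \fps_sum_(l \in Ppal_odd) 'q ^+ weight l = Fodd,
      \fps_sum_(l \in Ppal_even) 'q ^+ weight l = Feven &
      \fps_sum_(l \in Ppal) 'q ^+ weight l = 1 + Fodd + Feven].
Proof.
move=> oddF evenF Fodd Feven.
have sumP := summable_Ppal.
have sumO : fps_summable Ppal_odd (fun l => 'q ^+ weight l).
  by apply: sub_fps_summable sumP => l [].
have sumE : fps_summable Ppal_even (fun l => 'q ^+ weight l).
  by apply: sub_fps_summable sumP => l [].
have [sumOF defO] := @fps_sum_fiber _ _ _ _ [set m : nat | (0 <= m)%N]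
  (fun l => (size l)./2) _ oddF sumO (fun _ _ => isT)
  (fun m _ => esym (fps_sum_odd_length m)).
have [sumEF defE] : fps_summable [set m : nat | (1 <= m)%N] evenF /\
    \fps_sum_(l \in Ppal_even) 'q ^+ weight l = Feven.
  apply: (@fps_sum_fiber _ _ _ _ _ (fun l => (size l)./2) _ evenF sumE).
    by move=> l [_ /andP[]] /=; lia.
  by move=> m m_gt0; rewrite fps_sum_even_length.
split=> //; rewrite -/Fodd in defO; rewrite -defO -defE.
have -> : Ppal = [set [::]] `|` Ppal_odd `|` Ppal_even.
  apply/seteqP; split=> [l pal_l|l [[->|[]]|[]]] //.
  have [->|l_n0] := eqVneq l [::]; first by left; left.
  have [odd_l|even_l] := boolP (odd (size l)); first by left; right.
  by right; split=> //=; rewrite even_l lt0n size_eq0.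
have sum0 := @fps_summable_set1 int _ [::] (fun l => 'q ^+ weight l).
rewrite fps_sumU //; first last.
- by move=> l [[->|[_ odd_l]] [_ /andP[even_l //]]]; rewrite odd_l in even_l.
- by apply: sub_fps_summable sumP => l [->|[]].
by rewrite fps_sumU // ?fps_sum_set1 ?expr0 // => l [-> [_]].
Qed.
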